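(* Let $\Delta$ be a finite set of conditional domain constraints (CDCs), Y-UINDs, X-FDs and YX-FDs over $R$, where the set of CDCs and Y-UINDs in $\Delta$ is dp-controllable. Then the X-FDs, YX-FDs and Y-UINDs are $\{(\mathrm{dp})\}$-separable in $\Delta$ from the CDCs; that is, every horizontal decomposition of $R$ is lossless under $\Delta$ if and only if it is lossless under $\mathrm{cdc}(\Delta^* )$, where $\Delta^*$ is the closure of $\Delta$ under the domain propagation rule $(\mathrm{dp})$.
   Context: Setting. $\mathbf{dom}$ is a (possibly infinite) set of values; $\mathbf{idom}$ is a set of values from a specific interpreted domain (e.g. $\mathbb Z$) on which predicates and functions are defined according to a first-order language $\mathfrak C$ closed under negation. $R$ is a relation symbol of arity $n$ whose first $k$ positions are non-interpreted (values from $\mathbf{dom}$) and whose remaining $n-k$ positions are interpreted (values from $\mathbf{idom}$). Variables $\overline x=(x_1,\dots,x_k)$ refer to non-interpreted positions, $\overline y=(y_1,\dots,y_{n-k})$ to interpreted ones ($y_i$ refers to position $k+i$). $\mathfrak C$-formulae have free variables among $\overline y$. All instances (associating relation symbols with subsets of $\mathbf{dom}^k\times\mathbf{idom}^{n-k}$) are finite; entailment $\models$ is with respect to finite instances. A CDC is a formula $\forall\overline x,\overline y.\,(R(\overline x,\overline y)\land\lambda(\overline x))\to\delta(\overline y)$, written $\lambda(\overline x)\to\delta(\overline y)$, where $\lambda$ is a Boolean combination of equalities $x_i=a$ with $a\in\mathbf{dom}$ (possibly $\top$) and $\delta(\overline y)\in\mathfrak C$. $\mathrm{cdc}(\Gamma)$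 is the set of all CDCs in $\Gamma$. A Y-UIND $R[y_i]\subseteq R[y_j]$ is a unary inclusion dependency between interpreted positions: it is satisfied by $I$ if every value in column $i+k$ of $R^I$ appears in column $j+k$ of $R^I$. A functional dependency (FD) is written $A\to B$ with $A,B$ sets of positions of $R$ (any two tuples of $R^I$ agreeing on $A$ agree on $B$). An X-FD is an FD with $A$ and $B$ both consisting of non-interpreted positions; a YX-FD is an FD with $A$ consisting of interpreted and $B$ of non-interpreted positions. A horizontal decomposition $\Sigma$ is a finite set of view definitions, one for each view symbol $V_1,\dots,V_m$ (each of the same arity and position types as $R$), of the form $\forall\overline x,\overline y.\,V_i(\overline x,\overline y)\leftrightarrow(R(\overline x,\overline y)\land\lambda_i(\overline x)\land\sigma_i(\overline y))$, with $\lambda_i$ a Boolean combination of equalities as for CDCs (possibly $\top$) and $\sigma_i\in\mathfrak C$; the conjunct $\sigma_i$ may be absent. $\Sigma$ is lossless under a set $\Gamma$ of constraints over $R$ if $\Gamma\cup\Sigma\models\forall\overline x,\overline y.\,R(\overline x,\overline y)\leftrightarrow\bigvee_iV_i(\overline x,\overline y)$. Domain propagation rule $(\mathrm{dp})$: from a CDC $\top\to\delta(y_i)$ (where $y_i$ is the only free variable of $\delta$) and a Y-UIND $R[y_j]\subseteq R[y_i]$, derive the CDC $\top\to\delta(y_j)$, where the $\mathfrak C$-formula $\delta(y_j)$ is obtained by replacing $y_i$ with $y_j$. dp-controllable: a set of CDCs and Y-UINDs is dp-controllable if, for every Y-UIND $R[y_i]\subseteq R[y_j]$ in it with $i\ne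 j$, all CDCs in it mentioning the variable $y$, where $y$ is $y_i$ or $y_j$, are of the form $\top\to\delta(y)$ (with $y$ the only free variable of $\delta$). Separability: for a finite set $\mathcal S$ of sound inference rules, the constraints in $\Delta$ other than CDCs are $\mathcal S$-separable in $\Delta$ from the CDCs if every horizontal decomposition is lossless under $\Delta$ exactly when it is lossless under $\mathrm{cdc}(\Delta^* )$, with $\Delta^*$ the closure of $\Delta$ under $\mathcal S$. *)

(* Defs.v *)
(* Uses the Mathematical Components library, with the classical sets of
   MathComp-Analysis. *)
From mathcomp Require Import all_boot.
From mathcomp Require Import boolp classical_sets cardinality.

Set Implicit Arguments.
Unset Strict Implicit.
Unset Printing Implicit Defensive.

Local Open Scope classical_set_scope.

Record signature := Signature {
  fsym : Type;
  far : fsym -> nat;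
  psym : Type;
  par : psym -> nat
}.

Record structure (L : signature) (D : Type) := Structure {
  fint : forall f : fsym L, ('I_(far f) -> D) -> D;
  pint : forall p : psym L, ('I_(par p) -> D) -> Prop
}.

Inductive term (L : signature) (V : Type) : Type :=
  | tvar of V
  | tfun (f : fsym L) of ('I_(far f) -> term L V).
Arguments tvar {L V}.
Arguments tfun {L V}.

(* [V] is the type of the variables that may occur free. A quantifier binds the
   variable [None] of its body, whose remaining variables are the [Some v]; so
   bound variables have no name and replacing free ones cannot capture. *)
Inductive formula (L : signature) (V : Type) : Type :=
  | ftrue
  | feq of term L V & term L V
  | fpred (p : psym L) of ('I_(par p) -> term L V)
  | fnot of formula L V
  | fand of formula L V & formula L V
  | for_ of formula L V & formula L V
  | fimp of formula L V & formula L V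
  | fall of formula L (option V)
  | fex of formula L (option V).
Arguments ftrue {L V}.
Arguments feq {L V}.
Arguments fpred {L V}.
Arguments fnot {L V}.
Arguments fand {L V}.
Arguments for_ {L V}.
Arguments fimp {L V}.
Arguments fall {L V}.
Arguments fex {L V}.

Fixpoint teval (L : signature) (D : Type) (M : structure L D) (V : Type)
    (e : V -> D) (t : term L V) : D :=
  match t with
  | tvar v => e v
  | tfun f ts => fint M (fun i => teval M e (ts i))
  end.

Definition extend (D V : Type) (e : V -> D) (d : D) (o : option V) : D :=
  if o is Some v then e v else d.

Fixpoint holds (L : signature) (D : Type) (M : structure L D) (V : Type)
    (e : V -> D) (phi : formula L V) : Prop :=
  match phi with
  | ftrue => True
  | feq t u => teval M e t = teval M e u
  | fpred p ts => pint M (fun i => teval M e (ts i))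
  | fnot psi => ~ holds M e psi
  | fand psi chi => holds M e psi /\ holds M e chi
  | for_ psi chi => holds M e psi \/ holds M e chi
  | fimp psi chi => holds M e psi -> holds M e chi
  | fall psi => forall d, holds M (extend e d) psi
  | fex psi => exists d, holds M (extend e d) psi
  end.

Fixpoint tfree (L : signature) (V : Type) (t : term L V) (v : V) : Prop :=
  match t with
  | tvar w => w = v
  | tfun f ts => exists i, tfree (ts i) v
  end.

Fixpoint free (L : signature) (V : Type) (phi : formula L V) (v : V) : Prop :=
  match phi with
  | ftrue => False
  | feq t u => tfree t v \/ tfree u v
  | fpred p ts => exists i, tfree (ts i) v
  | fnot psi => free psi v
  | fand psi chi | for_ psi chi | fimp psi chi => free psi v \/ free chi v
  | fall psi | fex psi => free psi (Some v)
  end.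

Definition only_free (L : signature) (V : Type) (phi : formula L V) (v : V) :
    Prop :=
  forall w, free phi w <-> w = v.

Fixpoint trename (L : signature) (V W : Type) (s : V -> W) (t : term L V) :
    term L W :=
  match t with
  | tvar v => tvar (s v)
  | tfun f ts => tfun f (fun i => trename s (ts i))
  end.

Fixpoint rename (L : signature) (V W : Type) (s : V -> W) (phi : formula L V) :
    formula L W :=
  match phi with
  | ftrue => ftrue
  | feq t u => feq (trename s t) (trename s u)
  | fpred p ts => fpred p (fun i => trename s (ts i))
  | fnot psi => fnot (rename s psi)
  | fand psi chi => fand (rename s psi) (rename s chi)
  | for_ psi chi => for_ (rename s psi) (rename s chi)
  | fimp psi chi => fimp (rename s psi) (rename s chi)
  | fall psi => fall (rename (omap s) psi)
  | fex psi => fex (rename (omap s) psi)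
  end.

Definition replace_var (L : signature) (p : nat) (i j : 'I_p)
    (phi : formula L 'I_p) : formula L 'I_p :=
  rename (fun v => if v == i then j else v) phi.

(* The relation symbol [R] has arity [k + p]: [k] non-interpreted positions
   followed by [p] interpreted ones. The interpreted language is a set [C] of
   first-order formulas whose free variables are among the [p] variables [y];
   it need not contain all such formulas. *)

Definition closed_under_negation (L : signature) (V : Type)
    (C : set (formula L V)) : Prop :=
  forall phi, C phi -> C (fnot phi).

Definition tuple_over (dom idom : Type) (k p : nat) : Type :=
  (k.-tuple dom * p.-tuple idom)%type.

(* [inl i] is a non-interpreted position, [inr j] an interpreted one *)
Notation position k p := ('I_k + 'I_p)%type.

Inductive cond (dom : Type) (k : nat) : Type :=
  | ctop
  | ceq of 'I_k & dom
  | cnot of cond dom k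
  | cand of cond dom k & cond dom k
  | cor of cond dom k & cond dom k.
Arguments ctop {dom k}.
Arguments ceq {dom k}.
Arguments cnot {dom k}.
Arguments cand {dom k}.
Arguments cor {dom k}.

Fixpoint cond_holds (dom : Type) (k : nat) (x : k.-tuple dom) (l : cond dom k) :
    Prop :=
  match l with
  | ctop => True
  | ceq i a => tnth x i = a
  | cnot l1 => ~ cond_holds x l1
  | cand l1 l2 => cond_holds x l1 /\ cond_holds x l2
  | cor l1 l2 => cond_holds x l1 \/ cond_holds x l2
  end.

(* [CDC l delta] is [l(x) -> delta(y)]; [YUIND i j] is [R[y_i] <= R[y_j]];
   [FD A B] is [A -> B]. *)
Inductive constraint (dom : Type) (L : signature) (k p : nat) : Type :=
  | CDC of cond dom k & formula L 'I_p
  | YUIND of 'I_p & 'I_p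
  | FD of {set position k p} & {set position k p}.
Arguments CDC {dom L k p}.
Arguments YUIND {dom L k p}.
Arguments FD {dom L k p}.

Definition non_interpreted (k p : nat) : {set position k p} :=
  [set a | if a is inl _ then true else false]%SET.

Definition interpreted (k p : nat) : {set position k p} :=
  (~: non_interpreted k p)%SET.

Definition is_XFD k p (A B : {set position k p}) : Prop :=
  A \subset non_interpreted k p /\ B \subset non_interpreted k p.

Definition is_YXFD k p (A B : {set position k p}) : Prop :=
  A \subset interpreted k p /\ B \subset non_interpreted k p.

Definition admissible (dom : Type) (L : signature) (k p : nat)
    (C : set (formula L 'I_p))
    (c : constraint dom L k p) : Prop :=
  match c with
  | CDC _ delta => C delta
  | YUIND _ _ => True
  | FD A B => is_XFD A B \/ is_YXFD A B
  end.

Definition cdc (dom : Type) (L : signature) (k p : nat)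
    (G : set (constraint dom L k p)) : set (constraint dom L k p) :=
  [set c | G c /\ exists l delta, c = CDC l delta].

Definition yuind (dom : Type) (L : signature) (k p : nat)
    (G : set (constraint dom L k p)) : set (constraint dom L k p) :=
  [set c | G c /\ exists i j, c = YUIND i j].

Definition agree (dom idom : Type) (k p : nat) (A : {set position k p})
    (t u : tuple_over dom idom k p) : Prop :=
  forall a, a \in A ->
    match a with
    | inl i => tnth t.1 i = tnth u.1 i
    | inr j => tnth t.2 j = tnth u.2 j
    end.

Definition satisfies (dom idom : Type) (L : signature) (k p : nat)
    (M : structure L idom)
    (r : set (tuple_over dom idom k p)) (c : constraint dom L k p) : Prop :=
  match c with
  | CDC l delta =>
      forall x y, r (x, y) /\ cond_holds x l -> holds M (tnth y) delta
  | YUIND i j =>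
      forall t, r t -> exists2 u, r u & tnth u.2 j = tnth t.2 i
  | FD A B =>
      forall t u, r t -> r u -> agree A t u -> agree B t u
  end.

Record viewdef (dom : Type) (L : signature) (k p : nat)
    (C : set (formula L 'I_p)) := Viewdef {
  vcond : cond dom k;
  vsel : option (formula L 'I_p); (* [None] when the conjunct is absent *)
  vselP : forall s, vsel = Some s -> C s
}.

Definition decomposition (dom : Type) (L : signature) (k p : nat)
    (C : set (formula L 'I_p)) (m : nat) :=
  'I_m -> viewdef dom k C.

Inductive relsym (m : nat) : Type := relR | relV of 'I_m.
Arguments relR {m}.
Arguments relV {m}.

Definition instance (dom idom : Type) (k p m : nat) :=
  relsym m -> set (tuple_over dom idom k p).

Definition finite_instance (dom idom : Type) (k p m : nat)
    (I : instance dom idom k p m) :=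
  forall s, finite_set (I s).

Definition satisfies_view (dom idom : Type) (L : signature) (k p : nat)
    (M : structure L idom)
    (C : set (formula L 'I_p)) m (I : instance dom idom k p m) (i : 'I_m)
    (v : viewdef dom k C) : Prop :=
  forall x y, I (relV i) (x, y) <->
    [/\ I relR (x, y), cond_holds x (vcond v) &
        if vsel v is Some s then holds M (tnth y) s else True].

Definition lossless (dom idom : Type) (L : signature) (k p : nat)
    (M : structure L idom)
    (C : set (formula L 'I_p)) m (G : set (constraint dom L k p))
    (Sigma : decomposition dom k C m) : Prop :=
  forall I : instance dom idom k p m,
    finite_instance I ->
    (forall c, G c -> satisfies M (I relR) c) ->
    (forall i, satisfies_view M I i (Sigma i)) ->
    forall x y, I relR (x, y) <-> exists i, I (relV i) (x, y).

Definition rule (dom : Type) (L : signature) (k p : nat) :=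
  set (constraint dom L k p) -> constraint dom L k p -> Prop.

Definition sound (dom idom : Type) (L : signature) (k p : nat)
    (M : structure L idom) (d : rule dom L k p) : Prop :=
  forall P c, d P c ->
  forall r : set (tuple_over dom idom k p), finite_set r ->
    (forall q, P q -> satisfies M r q) -> satisfies M r c.

Inductive closure_under (dom : Type) (L : signature) (k p : nat)
    (S : set (rule dom L k p))
    (G : set (constraint dom L k p)) : set (constraint dom L k p) :=
  | closure_base c : G c -> closure_under S G c
  | closure_step d P c : S d -> d P c ->
      (forall q, P q -> closure_under S G q) -> closure_under S G c.

Inductive dp (dom : Type) (L : signature) (k p : nat) : rule dom L k p :=
  | dp_intro (delta : formula L 'I_p) (i j : 'I_p) : only_free delta i ->
      dp [set CDC ctop delta; YUIND j i]
         (CDC ctop (replace_var i j delta)).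
Arguments dp {dom L k p}.

Definition dp_controllable (dom : Type) (L : signature) (k p : nat)
    (G : set (constraint dom L k p)) : Prop :=
  forall i j, G (YUIND i j) -> i <> j ->
  forall v, v = i \/ v = j ->
  forall l delta, G (CDC l delta) -> free delta v ->
    l = ctop /\ only_free delta v.

(* The notion presupposes that [S] is a finite set of sound rules; this is made
   part of it. *)
Definition separable (dom idom : Type) (L : signature) (k p : nat)
    (M : structure L idom)
    (C : set (formula L 'I_p)) (S : set (rule dom L k p))
    (Delta : set (constraint dom L k p)) : Prop :=
  [/\ finite_set S,
      forall d, S d -> sound M d &
      forall m (Sigma : decomposition dom k C m),
        lossless M Delta Sigma <->
        lossless M (cdc (closure_under S Delta)) Sigma].

(* Main.v *)
(** Losslessness under [cdc] of the closure implies losslessness under [Delta]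
    by soundness of [dp]. Conversely, let [(x, y)] be a tuple of an instance of
    the closed CDCs that no view contains. Keep [x] and consider all [z] where
    every [z_j] is some [y_i] with [i] connected to [j] by a chain of Y-UINDs.
    This finite relation satisfies the FDs because [x] is constant, the Y-UINDs
    because they lie on chains, and the CDCs because, by dp-controllability, one
    that mentions an altered position constrains that position alone, and [dp]
    has propagated it back along the chain to [y_i]. *)
Require Import Defs.
From mathcomp Require Import all_boot.
From mathcomp Require Import boolp classical_sets cardinality.
From Stdlib Require Import Relation_Operators.

Set Implicit Arguments.
Unset Strict Implicit.
Unset Printing Implicit Defensive.

Local Open Scope classical_set_scope.

Lemma teval_ext (L : signature) (D V : Type) (M : structure L D)
    (e e' : V -> D) (t : term L V) :
  (forall v, tfree t v -> e v = e' v) -> teval M e t = teval M e' t.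
Proof.
elim: t => [v|f ts IH] /= ee'; first exact: ee'.
congr (fint M _); apply: funext => i; apply: IH => v fv.
by apply: ee'; exists i.
Qed.

(** The coincidence lemma. Under a quantifier both valuations receive the same value at [None], so
    they still agree on the free variables of the body. *)
Lemma holds_ext (L : signature) (D : Type) (M : structure L D) (V : Type)
    (phi : formula L V) (e e' : V -> D) :
  (forall v, free phi v -> e v = e' v) -> holds M e phi <-> holds M e' phi.
Proof.
elim: phi e e' => {V} [V|V t u|V q ts|V f IH|V f IHf g IHg|V f IHf g IHg
  |V f IHf g IHg|V f IH|V f IH] e e' /= ee'.
- by [].
- by rewrite (@teval_ext _ _ _ M e e' t) ?(@teval_ext _ _ _ M e e' u) //
    => v fv;
    apply: ee'; [right|left].
- suff -> : (fun i => teval M e (ts i)) = (fun i => teval M e' (ts i)) by [].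
  by apply: funext => i; apply: teval_ext => v fv; apply: ee'; exists i.
- by have := IH _ _ ee'; tauto.
- have := IHf e e' (fun v fv => ee' v (or_introl fv)).
  by have := IHg e e' (fun v fv => ee' v (or_intror fv)); tauto.
- have := IHf e e' (fun v fv => ee' v (or_introl fv)).
  by have := IHg e e' (fun v fv => ee' v (or_intror fv)); tauto.
- have := IHf e e' (fun v fv => ee' v (or_introl fv)).
  by have := IHg e e' (fun v fv => ee' v (or_intror fv)); tauto.
- have H d : holds M (extend e d) f <-> holds M (extend e' d) f.
    by apply: IH => -[v|] //= /ee'.
  by split=> Hd d; apply/H.
- have H d : holds M (extend e d) f <-> holds M (extend e' d) f.
    by apply: IH => -[v|] //= /ee'.
  by split=> -[d Hd]; exists d; apply/H.
Qed.

Lemma teval_rename (L : signature) (D V W : Type) (M : structure L D)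
    (s : V -> W) (e : W -> D) (t : term L V) :
  teval M e (trename s t) = teval M (e \o s) t.
Proof.
elim: t => [//|f ts IH] /=.
by congr (fint M _); apply: funext => i; apply: IH.
Qed.

Lemma holds_rename (L : signature) (D : Type) (M : structure L D) (V : Type)
    (phi : formula L V) (W : Type) (s : V -> W) (e : W -> D) :
  holds M e (rename s phi) <-> holds M (e \o s) phi.
Proof.
(* For the quantifier cases: [omap] fixes the bound variable [None], so renaming commutes with
   extending the valuation. *)
have ext_omap (V' W' : Type) (s' : V' -> W') (e' : W' -> D) d :
    extend e' d \o omap s' = extend (e' \o s') d.
  by apply: funext => -[].
elim: phi W s e => {V} [V|V t u|V q ts|V f IH|V f IHf g IHg|V f IHf g IHg
  |V f IHf g IHg|V f IH|V f IH] W s e /=.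
- by [].
- by rewrite !teval_rename.
- suff -> : (fun i => teval M e (trename s (ts i))) =
            (fun i => teval M (e \o s) (ts i)) by [].
  by apply: funext => i; rewrite teval_rename.
- by have := IH _ s e; tauto.
- by have := IHf _ s e; have := IHg _ s e; tauto.
- by have := IHf _ s e; have := IHg _ s e; tauto.
- by have := IHf _ s e; have := IHg _ s e; tauto.
- by split=> H d; have := H d; rewrite IH ext_omap.
- by split=> -[d H]; exists d; move: H; rewrite IH ext_omap.
Qed.

Lemma tfree_rename (L : signature) (V W : Type) (s : V -> W) (t : term L V) w :
  tfree (trename s t) w <-> exists2 v, tfree t v & s v = w.
Proof.
elim: t => [v|f ts IH] /=.
  by split=> [<-|[_ <- <-]] //; exists v.
split=> [[i /IH[v fv <-]]|[v [i fv] svw]]; first by exists v => //; exists i.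
by exists i; apply/IH; exists v.
Qed.

Lemma free_rename (L : signature) (V : Type) (phi : formula L V) (W : Type)
    (s : V -> W) w :
  free (rename s phi) w <-> exists2 v, free phi v & s v = w.
Proof.
have ex_or (T : Type) (A B Q : T -> Prop) :
    ((exists2 v, A v & Q v) \/ (exists2 v, B v & Q v)) <->
    exists2 v, A v \/ B v & Q v by firstorder.
have ex_omap (V' W' : Type) (s' : V' -> W') (A : option V' -> Prop) w' :
    (exists2 o, A o & omap s' o = Some w') <->
    exists2 v, A (Some v) & s' v = w'.
  split=> [[[v|] //= Av [<-]]|[v Av <-]]; first by exists v.
  by exists (Some v).
elim: phi W s w => {V} [V|V t u|V q ts|V f IH|V f IHf g IHg|V f IHf g IHg
  |V f IHf g IHg|V f IH|V f IH] W s w /=.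
- by split=> [|[]].
- by rewrite !tfree_rename ex_or.
- split=> [[i /tfree_rename[v fv <-]]|[v [i fv] <-]].
    by exists v => //; exists i.
  by exists i; apply/tfree_rename; exists v.
- exact: IH.
- by rewrite IHf IHg ex_or.
- by rewrite IHf IHg ex_or.
- by rewrite IHf IHg ex_or.
- by rewrite IH ex_omap.
- by rewrite IH ex_omap.
Qed.

(** This keeps the side condition of [dp] true, so that the rule can be iterated along a chain. *)
Lemma only_free_replace_var (L : signature) (p : nat) (i j : 'I_p)
    (phi : formula L 'I_p) :
  only_free phi i -> only_free (replace_var i j phi) j.
Proof.
move=> fi w; rewrite /replace_var free_rename; split.
  by move=> [v /fi -> <-]; rewrite eqxx.
by move=> ->; exists i; [exact/fi|rewrite eqxx].
Qed.

(** The inclusion gives each tuple a partner whose [i]-th interpreted value is its own [j]-th one.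
    The partner satisfies [delta], whose truth depends on that value alone. *)
Lemma dp_sound (dom idom : Type) (k p : nat) (L : signature)
    (M : structure L idom) : sound M (@dp dom L k p).
Proof.
move=> _ _ [delta i j fi] r _ sat x y [rxy _].
have [[x' y'] /= rxy' eq_ji] := sat (YUIND j i) (or_intror erefl) _ rxy.
have /= := sat (CDC ctop delta) (or_introl erefl) x' y' (conj rxy' I).
rewrite /replace_var holds_rename; apply: (iffLR (holds_ext M _)).
by move=> v /fi ->; rewrite /= eqxx.
Qed.

Lemma closure_under_sat (dom idom : Type) (k p : nat) (L : signature)
    (M : structure L idom) (S : set (rule dom L k p))
    (G : set (constraint dom L k p)) (r : set (tuple_over dom idom k p)) :
  (forall d, S d -> sound M d) -> finite_set r ->
  (forall c, G c -> satisfies M r c) ->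
  forall c, closure_under S G c -> satisfies M r c.
Proof.
move=> sndS finr satG c; elim=> {c} [c /satG //|d P c Sd dPc _ IH].
exact: (sndS _ Sd _ _ dPc).
Qed.

(** Links are added on the right: induction then removes the last inclusion first, which is the one
    that [dp] uses to carry a condition backwards. *)
Definition chain (dom : Type) (k p : nat) (L : signature)
    (G : set (constraint dom L k p)) : 'I_p -> 'I_p -> Prop :=
  clos_refl_trans_n1 _ (fun i j => G (YUIND i j)).

(** Controllability speaks only of Y-UINDs between distinct positions, so loops at the end of the
    chain must be skipped. *)
Lemma chain_last_move (dom : Type) (k p : nat) (L : signature)
    (G : set (constraint dom L k p)) i j :
  chain G i j -> i <> j -> exists2 h, G (YUIND h j) & h <> j.
Proof.
elim=> [/(_ erefl) []|h l Ghl _ IH il].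
by have [hl|] := pselect (h = l); [subst l; exact: IH|exists h].
Qed.

(* A constant valuation is unaffected by the renamings that [dp] performs. *)
Lemma chain_holds (dom idom : Type) (k p : nat) (L : signature)
    (M : structure L idom) (G : set (constraint dom L k p))
    (r : set (tuple_over dom idom k p)) x y i j delta :
  (forall c, cdc (closure_under [set dp] G) c -> satisfies M r c) ->
  r (x, y) -> chain G i j -> only_free delta j ->
  closure_under [set dp] G (CDC ctop delta) ->
  holds M (fun=> tnth y i) delta.
Proof.
move=> satr rxy ch; elim: ch delta => [|h l hl _ IH] delta fdelta Gdelta.
  apply: (iffLR (@holds_ext _ _ _ _ _ (tnth y) _ _)); last first.
    by apply: (satr (CDC ctop delta) _ x y); [split=> //; exists ctop, delta|].
  by move=> v /fdelta ->.
(* One use of [dp] on the last link moves the condition from [l] to [h], where the shorter chain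
   applies. *)
have := IH (replace_var l h delta) (only_free_replace_var h fdelta).
rewrite /replace_var holds_rename; apply.
apply: (closure_step _ (dp_intro dom k h fdelta)) => //.
by move=> q [->|->] //; apply: closure_base.
Qed.

(** [f j] is the column of [y] from which column [j] takes its value. Indexing by maps between
    positions makes finiteness immediate even if [idom] is infinite. *)
Definition chase (dom idom : Type) (k p : nat) (L : signature)
    (G : set (constraint dom L k p)) (x : k.-tuple dom) (y : p.-tuple idom) :
    set (tuple_over dom idom k p) :=
  [set (x, [tuple tnth y (f j) | j < p]) |
    f in [set f : {ffun 'I_p -> 'I_p} | forall j, chain G (f j) j]].

Lemma chase_finite (dom idom : Type) (k p : nat) (L : signature)
    (G : set (constraint dom L k p)) (x : k.-tuple dom) (y : p.-tuple idom) :
  finite_set (chase G x y).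
Proof. by apply: finite_image; exact: finite_finset. Qed.

Lemma chase_self (dom idom : Type) (k p : nat) (L : signature)
    (G : set (constraint dom L k p)) (x : k.-tuple dom) (y : p.-tuple idom) :
  chase G x y (x, y).
Proof.
exists [ffun j => j]; first by move=> j; rewrite ffunE; exact: rtn1_refl.
by congr (_, _); apply: eq_from_tnth => j; rewrite tnth_mktuple ffunE.
Qed.

Lemma chase_yuind (dom idom : Type) (k p : nat) (L : signature)
    (M : structure L idom) (G : set (constraint dom L k p))
    (x : k.-tuple dom) (y : p.-tuple idom) i j :
  G (YUIND i j) -> satisfies M (chase G x y) (YUIND i j).
Proof.
move=> Gij _ [f chf <-].
(* Column [j] now takes its value from the source of column [i]; the chain from [f i] to [i] is
   extended by the given inclusion. *)
pose g := [ffun l => if l == j then f i else l].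
exists (x, [tuple tnth y (g l) | l < p]).
  exists g => // l; rewrite ffunE; case: eqP => [->|_]; last exact: rtn1_refl.
  exact: rtn1_trans Gij (chf i).
by rewrite /= !tnth_mktuple ffunE eqxx.
Qed.

Lemma chase_fd (dom idom : Type) (k p : nat) (L : signature)
    (M : structure L idom) (G : set (constraint dom L k p))
    (x : k.-tuple dom) (y : p.-tuple idom)
    (A B : {set position k p}) : B \subset non_interpreted k p ->
  satisfies M (chase G x y) (FD A B).
Proof.
move=> /fintype.subsetP Bx _ _ [f _ <-] [g _ <-] _ [i|j] //= /Bx.
by rewrite inE.
Qed.

Lemma chase_cdc (dom idom : Type) (k p : nat) (L : signature)
    (M : structure L idom) (G : set (constraint dom L k p))
    (x : k.-tuple dom) (y : p.-tuple idom)
    (r0 : set (tuple_over dom idom k p)) l delta :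
  dp_controllable (cdc G `|` yuind G) ->
  (forall c, cdc (closure_under [set dp] G) c -> satisfies M r0 c) ->
  r0 (x, y) -> G (CDC l delta) -> satisfies M (chase G x y) (CDC l delta).
Proof.
move=> ctrl satr0 r0xy Gd _ _ [[f chf [<- <-]] lx].
(* Either some free variable of [delta] has a new source column, or [delta] reads the same values as
   at [y]. *)
have [[v fv fvv]|nex] := pselect (exists2 v, free delta v & f v <> v).
  have [ltop onlyv] : l = ctop /\ only_free delta v.
    have [i Giv iv] := chain_last_move (chf v) fvv.
    apply: (ctrl i v _ iv v (or_intror erefl)) => //.
      by right; split=> //; exists i, v.
    by left; split=> //; exists l, delta.
  have Gtop : closure_under [set dp] G (CDC ctop delta).
    by apply: closure_base; rewrite -ltop.
  have := chain_holds satr0 r0xy (chf v) onlyv Gtop.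
  apply: (iffLR (holds_ext M _)) => w /onlyv ->.
  by rewrite tnth_mktuple.
apply: (iffLR (@holds_ext _ _ _ _ _ (tnth y) _ _)).
  move=> w fw; rewrite tnth_mktuple; congr tnth.
  by apply: contrapT => nw; apply: nex; exists w => // /esym.
apply: (satr0 (CDC l delta) _ x y) => //.
by split; [exact: closure_base|exists l, delta].
Qed.

Unset Implicit Arguments.

Theorem theorem12 (dom idom : Type) (k p : nat) (L : signature)
    (M : structure L idom) (C : set (formula L 'I_p))
    (negC : closed_under_negation C)
    (Delta : set (constraint dom L k p))
    (finDelta : finite_set Delta)
    (admDelta : forall c, Delta c -> admissible C c)
    (ctrlDelta : dp_controllable (cdc Delta `|` yuind Delta)) :
  separable M C [set dp] Delta.
Proof.
have snd d : [set @dp dom L k p] d -> sound M d by move=> ->; exact: dp_sound.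
split=> // m Sigma; split=> lossy J finJ satJ viewJ x y; last first.
  apply: lossy => // c [Dc _].
  exact: closure_under_sat Dc.
split=> [Jxy|[i /viewJ[]//]].
pose r := chase Delta x y.
pose V i : set (tuple_over dom idom k p) :=
  [set t | [/\ r t, cond_holds t.1 (vcond (Sigma i)) &
     if vsel (Sigma i) is Some s then holds M (tnth t.2) s else True]].
(* The views are computed from the chase by their definitions in [Sigma]. *)
pose J' : instance dom idom k p m :=
  fun s => if s is relV i then V i else r.
have finr : finite_set r := chase_finite _ _ _.
have finJ' : finite_instance J'.
  by case=> [|i] //=; apply: sub_finite_set finr => t [].
have satJ' c : Delta c -> satisfies M (J' relR) c.
  case: c => [l delta|i j|A B] Dc.
  - exact: (chase_cdc (r0 := J relR)).
  - exact: chase_yuind.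
  - by apply: chase_fd; case: (admDelta _ Dc) => -[].
have viewJ' i : satisfies_view M J' i (Sigma i) by [].
(* The conditions of view [i] concern only [x] and [y], so they carry over from [J'] to [J]. *)
have [/(_ (chase_self _ _ _))[i [_ cx sy]] _] :=
  lossy J' finJ' satJ' viewJ' x y.
by exists i; apply/viewJ.
Qed.
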